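(* Let $N$ be an H-type group with H-type subgroup $N_1$, let $S_1=N_1A\subseteq S=NA$ be the corresponding solvable extensions, and let $D_{s,k}$ be the left-invariant differential operators on $N$ defined recursively in the context. Let $R:C_c^\infty(N)\to C_c^\infty(N_1)$ be restriction of functions to $N_1$. For each $k\ge0$ (and each $\nu\in\mathbb C$ for which $D_{-\frac{\nu}{2},k}$ is defined) the operator $$\mathcal D_{\nu,k}:=R\circ D_{-\frac{\nu}{2},k}:C_c^\infty(N)\to C_c^\infty(N_1)$$ is $S_1$-intertwining from $\pi_\nu|_{S_1}$ to $\pi^\flat_{\nu+2k}$, i.e. $\mathcal D_{\nu,k}\,\pi_\nu(g)f=\pi^\flat_{\nu+2k}(g)\,\mathcal D_{\nu,k}f$ for all $g\in S_1$ and $f\in C_c^\infty(N)$.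
   Context: H-type algebras and groups. Let $\mathfrak n$ be a finite-dimensional real Lie algebra with inner product $\langle\cdot,\cdot\rangle$ (norm $|\cdot|$) and orthogonal decomposition $\mathfrak n=\mathfrak v\oplus\mathfrak z$ with $[\mathfrak v,\mathfrak v]=\mathfrak z$, $[\mathfrak v,\mathfrak z]=0$ (and $\mathfrak z$ central). For $Z\in\mathfrak z$ define $J_Z:\mathfrak v\to\mathfrak v$ by $\langle J_ZX,Y\rangle=\langle Z,[X,Y]\rangle$. $\mathfrak n$ is called of H-type if $J_Z^2=-16|Z|^2\,\mathrm{id}$ for all $Z\in\mathfrak z$ (note the factor 16). The abelian case $\mathfrak z=0$ is allowed. Put $p=\dim\mathfrak v$, $q=\dim\mathfrak z$, $\rho=\frac{p+2q}{2}$. The group $N$ is $\mathfrak n$ with product $(X,Z)\cdot(Y,W)=(X+Y,Z+W+\frac12[X,Y])$. H-type subgroup. $\mathfrak v=\mathfrak v_1\oplus\mathfrak v_2$ is an orthogonal decomposition with $[\mathfrak v_1,\mathfrak v_2]=0$ and $[\mathfrak v_1,\mathfrak v_1]=\mathfrak z$; $\mathfrak n_1=\mathfrak v_1\oplus\mathfrak z$, and $N_1\subseteq N$ is the corresponding subgroup. Put $p_i=\dim\mathfrak v_i$, $\rho_1=\frac{p_1+2q}{2}$. Solvable extensions and representations. $A=\mathbb R_+$ acts on $N$ by $t\cdot(X,Z)=(tX,t^2Z)$; $S=N\rtimes A$ and $S_1=N_1\rtimes A\subseteq S$. For $\nu\in\mathbb C$, $\pi_\nu$ is the representation of $S$ on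 $X_\nu^\infty=C_c^\infty(N)$ given by $\pi_\nu(n)f(n')=f(n^{-1}n')$ for $n\in N$ and $\pi_\nu(t)f(X,Z)=t^{-\nu}f(t^{-1}X,t^{-2}Z)$ for $t\in A$. $\pi_\nu^\flat$ is the representation of $S_1$ on $X_\nu^{\flat,\infty}=C_c^\infty(N_1)$ given by the same formulas. Differential operators. Each $S\in\mathfrak n$ acts as a left-invariant vector field $(Sf)(n)=\frac{d}{dt}f(n\exp(tS))|_{t=0}$. For orthonormal bases $(S_j)_{j\le p_1}$ of $\mathfrak v_1$, $(S_j)_{p_1<j\le p}$ of $\mathfrak v_2$, $(T_j)$ of $\mathfrak z$: $\Delta_1=\sum_{j\le p_1}S_j^2$, $\Delta_2=\sum_{j>p_1}S_j^2$, $\Delta=\Delta_1+\Delta_2$, $\Box=\sum_jT_j^2$. The operators $D_{s,k}$. With $B(s)=4s(4s+2\rho-2)$, set $D_{s,0}=1$, $$D_{s,1}=\frac{1}{8s(4s+2\rho-2)(2s+q-1)}\big((4s+2\rho-2)\Delta_2-p_2\Delta\big),$$ and for $k\ge1$ $$D_{s,k+1}=\frac{1}{8(s-k)(4s+2\rho-2)(2s+q-2k-1)}\Big[\big((4s+2\rho-2)\Delta_2-(4k+p_2)\Delta\big)D_{s,k}-\frac{2k(2k+p_2-2)(4s+2\rho_1-4k-2)}{2B(s)(2s+q-1)(4s+2\rho-4)}\big(\Delta^2+4(4s+2\rho-2)^2\Box\big)D_{s-1,k-1}\Big].$$ This is read as a recursion of rational functions of $s$ with values in left-invariant differential operators; $D_{s,k}$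 is defined at $s$ if $s$ is not a pole. *)

(* Defs.v *)
From HB Require Import structures.
From mathcomp Require Import all_boot all_order all_algebra.
From mathcomp Require Import sesquilinear complex.
From mathcomp Require Import all_classical all_reals all_analysis.

Set Implicit Arguments.
Unset Strict Implicit.
Unset Printing Implicit Defensive.

Import Order.TTheory GRing.Theory Num.Theory.
Import numFieldNormedType.Exports.

Local Open Scope classical_set_scope.
Local Open Scope ring_scope.

(* The subspace [U, W] spanned by the brackets of elements of U and W. *)
Definition bracketv (R : realType) (V Z : vectType R)
    (br : {bilinear V -> V -> Z}) (U W : {vspace V}) : {vspace Z} :=
  <<[seq br x y | x <- vbasis U, y <- vbasis W]>>%VS.

(* An H-type algebra n = v (+) z, presented as the orthogonal external sum of
   hv and hz.  As z is central and [v, v] = z, the Lie bracket of n is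
   [(X, Z), (Y, W)] = (0, br X Y); the Jacobi identity is then automatic.
   J is determined by hJP, because dotv is nondegenerate. *)
Record htype (R : realType) := HType {
  hv : vectType R;
  hz : vectType R;
  dotv : {dot hv for idfun};
  dotz : {dot hz for idfun};
  hbr : {bilinear hv -> hv -> hz};
  hbr_alt : forall X, hbr X X = 0;
  hbr_full : bracketv hbr fullv fullv = fullv;
  hJ : hz -> hv -> hv;
  hJP : forall Z X Y, dotv (hJ Z X) Y = dotz Z (hbr X Y);
  hJ2 : forall Z X, hJ Z (hJ Z X) = - (16 * dotz Z Z) *: X }.

(* The orthogonal decompositions v = v1 (+) v2 that define an H-type subgroup
   N1, with Lie algebra v1 (+) z. *)
Record htype_sub (R : realType) (n : htype R) (v1 v2 : {vspace hv n}) : Prop :=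
  HTypeSub {
    sub_add : (v1 + v2)%VS = fullv;
    sub_ortho : forall X Y, X \in v1 -> Y \in v2 -> dotv n X Y = 0;
    sub_br12 : bracketv (hbr n) v1 v2 = 0%VS;
    sub_br11 : bracketv (hbr n) v1 v1 = fullv }.

(* A finite-dimensional real vector space carries the topology and the smooth
   structure transported from row vectors by a basis; the choice of the basis
   does not matter. *)
Section SmoothFunctions.
Variable R : realType.

(* C^m: the partial derivatives exist and are of class C^(m-1). *)
Fixpoint Ck (m d : nat) (h : 'rV[R]_d -> R) : Prop :=
  continuous h /\
  if m is m'.+1 then
    forall j : 'I_d, (forall x, derivable h x (delta_mx 0 j)) /\
                     Ck m' ('D_(delta_mx 0 j) h)
  else True.

Variable V : vectType R.

Definition of_coords (u : 'rV[R]_(\dim {:V})) : V :=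
  \sum_(j < \dim {:V}) u 0 j *: (vbasis {:V})`_j.

Definition smooth (f : V -> R[i]) : Prop :=
  forall m, Ck m (fun u => complex.Re (f (of_coords u))) /\
            Ck m (fun u => complex.Im (f (of_coords u))).

Definition compactly_supported (f : V -> R[i]) : Prop :=
  compact (closure [set u | f (of_coords u) != 0]).

Definition Cc_smooth (f : V -> R[i]) : Prop := smooth f /\ compactly_supported f.

End SmoothFunctions.

(* The group structure on V * Z defined by a bracket br : V -> V -> Z, and the
   representation of (V * Z) x| R_+ on functions on V * Z.  The pair (n, t)
   stands for the element n t of the semidirect product. *)
Section Group.
Variables (R : realType) (V Z : vectType R) (br : V -> V -> Z).
Local Notation N := (V * Z)%type.

Definition gmul (x y : N) : N :=
  (x.1 + y.1, x.2 + y.2 + 2^-1 *: br x.1 y.1).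

Definition ginv (x : N) : N := (- x.1, - x.2).

Definition dil (t : R) (x : N) : N := (t *: x.1, t ^+ 2 *: x.2).

(* t ^ z for t > 0. *)
Definition cpowR (t : R) (z : R[i]) : R[i] :=
  (expR (complex.Re z * ln t))%:C%C *
  (cos (complex.Im z * ln t) +i* sin (complex.Im z * ln t))%C.

Definition rep (nu : R[i]) (g : N * R) (f : N -> R[i]) : N -> R[i] :=
  let piA f := fun x : N => cpowR g.2 (- nu) * f (dil g.2^-1 x) in
  let piN f := fun x : N => f (gmul (ginv g.1) x) in
  piN (piA f).

(* The exponential map of N is the identity of V * Z. *)
Definition lvf (Y : N) (f : N -> R[i]) (x : N) : R[i] :=
  (derive1 (fun t : R => complex.Re (f (gmul x (t *: Y)))) 0 +i*
   derive1 (fun t : R => complex.Im (f (gmul x (t *: Y)))) 0)%C.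

Definition word_act (w : seq N) (f : N -> R[i]) : N -> R[i] := foldr lvf f w.

End Group.

(* A list of pairs (c, [:: S_1; ...; S_m]) stands for the left-invariant
   differential operator sum c S_1 ... S_m with coefficients c in F. *)
Definition diffop (F : fieldType) (N : Type) := seq (F * seq N).

Section DiffOp.
Variables (F : fieldType) (N : Type).
Implicit Types A B : diffop F N.

Definition op1 : diffop F N := [:: (1, [::])].
Definition opadd A B : diffop F N := A ++ B.
Definition opscale (c : F) A : diffop F N := [seq (c * a.1, a.2) | a <- A].
Definition opmul A B : diffop F N :=
  [seq (a.1 * b.1, a.2 ++ b.2) | a <- A, b <- B].
Definition opsub A B : diffop F N := opadd A (opscale (- 1) B).
Definition sum_squares (s : seq N) : diffop F N :=
  [seq (1, [:: X; X]) | X <- s].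

End DiffOp.

(* D_{s,k} with s an arbitrary element of a field F.  The parameters p1, p2, q
   are the dimensions of v1, v2, z. *)
Section Recursion.
Variables (F : fieldType) (N : Type) (p1 p2 q : nat).
Variables (Lap1 Lap2 Box : diffop F N).

Let Lap := opadd Lap1 Lap2.
Let rho : F := (p1 + p2 + 2 * q)%:R / 2.
Let rho1 : F := (p1 + 2 * q)%:R / 2.
Let B (s : F) : F := 4 * s * (4 * s + 2 * rho - 2).

Fixpoint Dsk (k : nat) (s : F) : diffop F N :=
  match k with
  | 0 => op1 F N
  | k'.+1 =>
    match k' with
    | 0 =>
      opscale (8 * s * (4 * s + 2 * rho - 2) * (2 * s + q%:R - 1))^-1
        (opsub (opscale (4 * s + 2 * rho - 2) Lap2) (opscale p2%:R Lap))
    | k''.+1 =>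
      let c := k'%:R in
      opscale (8 * (s - c) * (4 * s + 2 * rho - 2)
               * (2 * s + q%:R - 2 * c - 1))^-1
        (opsub
          (opmul (opsub (opscale (4 * s + 2 * rho - 2) Lap2)
                        (opscale (4 * c + p2%:R) Lap))
                 (Dsk k' s))
          (opscale
            (2 * c * (2 * c + p2%:R - 2) * (4 * s + 2 * rho1 - 4 * c - 2)
             / (2 * B s * (2 * s + q%:R - 1) * (4 * s + 2 * rho - 4)))
            (opmul (opadd (opmul Lap Lap)
                          (opscale (4 * (4 * s + 2 * rho - 2) ^+ 2) Box))
                   (Dsk k'' (s - 1)))))
    end
  end.

End Recursion.

Section HTypeOperators.
Variables (R : realType) (n : htype R) (v1 v2 : {vspace hv n}).
Local Notation C := R[i].
Local Notation N := (hv n * hz n)%type.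
Local Notation N1 := (subvs_of v1 * hz n)%type.

(* C(s) *)
Local Notation K := {fraction {poly C}}.
Local Notation "p %:F" := (@FracField.tofrac {poly C} p).

Definition hbr1 (X Y : subvs_of v1) : hz n := hbr n (vsval X) (vsval Y).

Definition inclN1 (x : N1) : N := (vsval x.1, x.2).

Definition restrN1 (f : N -> C) : N1 -> C := f \o inclN1.

Definition pi_rep (nu : C) : N * R -> (N -> C) -> N -> C := rep (hbr n) nu.

Definition pi_flat (nu : C) : N1 * R -> (N1 -> C) -> N1 -> C := rep hbr1 nu.

Definition op_act (E : diffop C N) (f : N -> C) (x : N) : C :=
  \sum_(a <- E) a.1 * word_act (hbr n) a.2 f x.

(* For an operator with coefficients in C(s), D f (x) is an element of C(s). *)
Definition op_actK (D : diffop K N) (f : N -> C) (x : N) : K :=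
  \sum_(a <- D) a.1 * ((word_act (hbr n) a.2 f x)%:P)%:F.

Definition op_eqK (D D' : diffop K N) : Prop :=
  forall f, smooth f -> op_actK D f =1 op_actK D' f.

(* The operator-valued rational function D has no pole at s0, and E is its
   value there: D = P / d for a polynomial P in s with operator coefficients
   and a scalar polynomial d with d(s0) <> 0, and E = P(s0) / d(s0).  The
   equality D = P / d is one of operators, so that factors which only cancel
   because of relations between operators do not count as poles. *)
Definition value_at (D : diffop K N) (s0 : C) (E : diffop C N) : Prop :=
  exists (P : seq ({poly C} * seq N)) (d : {poly C}),
    [/\ d.[s0] != 0,
        op_eqK D [seq (a.1%:F / d%:F, a.2) | a <- P] &
        E = [seq (a.1.[s0] / d.[s0], a.2) | a <- P]].

Definition orthonormal_basis (U : vectType R) (dot : {dot U for idfun})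
    (W : {vspace U}) (e : seq U) : Prop :=
  basis_of W e /\ orthonormal dot e.

Variables (S1 S2 : seq (hv n)) (T : seq (hz n)).

(* D_{s,k} as a rational function: the recursion over C(s), at s = 'X. *)
Definition Drat (k : nat) : diffop K N :=
  Dsk (\dim v1) (\dim v2) (\dim {:hz n})
    (sum_squares K [seq (X, 0) : N | X <- S1])
    (sum_squares K [seq (X, 0) : N | X <- S2])
    (sum_squares K [seq (0, Z) : N | Z <- T])
    k ('X%:F).

End HTypeOperators.

Arguments inclN1 {R n} v1 x.
Arguments restrN1 {R n} v1 f _.

(* Main.v *)
(* Left-invariant operators commute with left translations, so only the action
   of A has to be examined.  The dilations are automorphisms of N that scale v by
   t and z by t^2; hence every word S_1 ... S_m occurring in D_{s,k} is
   homogeneous of degree 2k, which turns t^(-nu) into t^(-nu-2k).  The homogeneity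
   of D_{s,k} over C(s) passes to its value at s = -nu/2 by clearing the
   denominator and evaluating polynomials.
   Differentiation along a left-invariant field is a directional derivative whose
   direction is affine in the point.  Since continuous partial derivatives make
   directional derivatives linear in the direction (mean value theorem), these
   fields preserve smooth functions. *)

Require Import Defs.
From HB Require Import structures.
From mathcomp Require Import all_boot all_order all_algebra.
From mathcomp Require Import sesquilinear complex.
From mathcomp Require Import all_classical all_reals all_analysis.

Set Implicit Arguments.
Unset Strict Implicit.
Unset Printing Implicit Defensive.

Import Order.TTheory GRing.Theory Num.Theory.
Import numFieldNormedType.Exports.

Local Open Scope classical_set_scope.
Local Open Scope ring_scope.

(** * Directional derivatives and their linearity in the direction *)

Lemma is_derive_comp_line {R : numFieldType} {U V W : normedModType R}
    (phi : U -> V) (h : V -> W) x v w d :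
  (forall k : R, phi (k *: v + x) = k *: w + phi x) ->
  is_derive (phi x) w h d -> is_derive x v (h \o phi) d.
Proof.
move=> phix [hd <-].
(* The two difference quotients coincide for every [k], so existence and value of the limit transfer
   together. *)
suff E : (fun k : R => k^-1 *: ((h \o phi \o shift x) (k *: v) - (h \o phi) x))
    = (fun k : R => k^-1 *: ((h \o shift (phi x)) (k *: w) - h (phi x))).
  by split; rewrite /derivable /derive E.
by apply/funext => k /=; rewrite phix.
Qed.

Section DirectionalDerivatives.
Context {R : realType} {V : normedModType R}.
Implicit Types (h : V -> R) (x y v e : V).

Lemma is_derive_line h y e (s : R) : derivable h (s *: e + y) e ->
  is_derive s (1 : R) (fun s : R => h (s *: e + y)) ('D_e h (s *: e + y)).
Proof.
move=> /derivableP.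
apply: (@is_derive_comp_line _ R V R (fun s => s *: e + y) h).
by move=> k; rewrite [k *: (1 : R)]mulr1 scalerDl addrA.
Qed.

(** The mean value theorem for [s |-> h (s *: e + y)] between 0 and [a]; bounding $|c|$ by $|a|$
    covers both signs of [a]. *)
Lemma MVT_line h y e (a : R) : (forall z, derivable h z e) ->
  exists2 c : R, `|c| <= `|a| &
    h (a *: e + y) - h y = a * 'D_e h (c *: e + y).
Proof.
move=> hd; pose g (s : R) := h (s *: e + y).
have gd s : is_derive s (1 : R) g ('D_e h (s *: e + y)) by exact: is_derive_line.
have gc (i : interval R) : {within [set` i], continuous g}.
  by apply: derivable_within_continuous => s _; have [] := gd s.
have g0 : g 0 = h y by rewrite /g scale0r add0r.
have [a0|/ltW a0] := leP 0 a.
  have [c] := MVT_segment a0 (fun s _ => gd s) (gc _).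
  rewrite in_itv/= => /andP[c0 ca]; rewrite g0 subr0 mulrC => E.
  by exists c => //; rewrite !ger0_norm.
have [c] := MVT_segment a0 (fun s _ => gd s) (gc _).
rewrite in_itv/= => /andP[ca c0]; rewrite g0 sub0r => E.
exists c; first by rewrite !ler0_norm// lerN2.
by apply: oppr_inj; rewrite opprB [LHS]E mulrN mulrC.
Qed.

(** The increment along [a *: e + v] is split at the intermediate point [k *: v + x]. The mean value
    theorem turns the part along [e] into [k * a] times ['D_e h] at a point tending to [x], where
    continuity applies. Differentiability along [v] is asked at [x] alone, so directions can be
    added one by one. *)
Lemma is_derive_addl h x v e (a : R) : (forall z, derivable h z e) ->
  {for x, continuous ('D_e h)} -> derivable h x v ->
  is_derive x (a *: e + v) h (a * 'D_e h x + 'D_v h x).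
Proof.
move=> hd hc hv.
suff cv : (fun k : R => k^-1 *: ((h \o shift x) (k *: (a *: e + v)) - h x))
    @ 0^' --> a * 'D_e h x + 'D_v h x.
  by split; [apply/cvg_ex; exists (a * 'D_e h x + 'D_v h x)|exact: cvg_lim].
have -> : (fun k : R => k^-1 *: ((h \o shift x) (k *: (a *: e + v)) - h x)) =
    (fun k => k^-1 *: (h ((k * a) *: e + (k *: v + x)) - h (k *: v + x))) \+
    (fun k => k^-1 *: ((h \o shift x) (k *: v) - h x)).
  by apply/funext => k /=; rewrite -scalerDr subrKA (scalerDr k) scalerA -addrA.
apply: cvgD => //.
apply/cvgrPdist_le => eps eps0.
(* The 1 keeps the denominator positive when [a] is 0. *)
have eps1 : 0 < eps / (`|a| + 1) by rewrite divr_gt0// ltr_wpDl.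
move: hc => /cvgrPdist_le/(_ _ eps1)/nbhs_ballP[/= d d0 hdist].
(* For $|c|\le|ka|$ the point [c *: e + (k *: v + x)] is within $|k|M$ of [x]; the 1 makes [M]
   positive. *)
pose M := `|a| * `|e| + `|v| + 1.
have M0 : 0 < M by rewrite ltr_wpDl// addr_ge0// mulr_ge0.
near=> k.
have k0 : k != 0 by near: k; exact: nbhs_dnbhs_neq.
have kd : `|k| < d / M.
  near: k; apply: nbhs_dnbhs.
  apply/nbhs_ballP; exists (d / M) => /=; first by rewrite divr_gt0.
  by move=> k; rewrite /ball /= sub0r normrN.
have [c cka ->] := MVT_line (k *: v + x) (k * a) hd.
rewrite -mulrA [_ *: _]mulrA mulVf// mul1r -mulrBr normrM.
have /hdist : ball x d (c *: e + (k *: v + x)).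
  rewrite -ball_normE /ball_ /= distrC addrA addrK.
  apply: (@le_lt_trans _ _ (`|k| * M)); last by rewrite -ltr_pdivlMr.
  apply: (le_trans (ler_normD _ _)); rewrite !normrZ /M !mulrDr -addrA lerD//.
    by rewrite mulrA -normrM ler_wpM2r.
  by rewrite lerDl mulr1.
move=> /(ler_wpM2l (normr_ge0 a)) /le_trans; apply.
rewrite mulrCA ger_pMr// ler_pdivrMr ?mul1r ?lerDl// ltr_wpDl//.
Unshelve. all: by end_near. Qed.

End DirectionalDerivatives.

(** * Functions of class $C^m$ on row vectors *)

Section CkCalculus.
Context {R : realType}.
Implicit Types (m d : nat).

Lemma Ck_continuous m d (h : 'rV[R]_d -> R) : Ck m h -> continuous h.
Proof. by case: m => [|m] []. Qed.

Arguments Ck_continuous {m d h}.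

Lemma CkW m d (h : 'rV[R]_d -> R) : Ck m.+1 h -> Ck m h.
Proof.
elim: m h => [|m IH] h [hc hd]; first by split.
by split => // j; have [? /IH] := hd j.
Qed.

Lemma Ck_derivable m d (h : 'rV[R]_d -> R) x j : Ck m.+1 h ->
  derivable h x (delta_mx 0 j).
Proof. by move=> [_ /(_ j)[]]. Qed.

Lemma Ck_derive m d (h : 'rV[R]_d -> R) j : Ck m.+1 h ->
  Ck m ('D_(delta_mx 0 j) h).
Proof. by move=> [_ /(_ j)[]]. Qed.

(** Starting from the zero direction, [is_derive_addl] adds the coordinate directions of [v] one at
    a time; class $C^1$ supplies the continuous partial derivatives. *)
Lemma Ck_is_derive m d (h : 'rV[R]_d -> R) x v : Ck m.+1 h ->
  is_derive x v h (\sum_j v 0 j * 'D_(delta_mx 0 j) h x).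
Proof.
move=> hC; rewrite {1}(row_sum_delta v).
elim: (index_enum _) => [|j s IH]; first by rewrite !big_nil; exact: is_derive0.
have [IHd IHv] := IH.
rewrite !big_cons -IHv; apply: is_derive_addl => // [z|].
  exact: Ck_derivable hC.
exact: Ck_continuous (Ck_derive j hC) x.
Qed.

Lemma CkSP m d (h : 'rV[R]_d -> R) (h' : 'I_d -> 'rV[R]_d -> R) :
  continuous h ->
  (forall j x, is_derive x (delta_mx 0 j) h (h' j x)) ->
  (forall j, Ck m (h' j)) -> Ck m.+1 h.
Proof.
move=> hc hd hC; split => // j; split => [x|]; first by have [] := hd j x.
by have -> : 'D_(delta_mx 0 j) h = h' j by apply/funext => x; exact: derive_val.
Qed.

Lemma Ck_cst m d (c : R) : Ck m (fun _ : 'rV[R]_d => c).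
Proof.
elim: m c => [|m IH] c; first by split => //; exact: cst_continuous.
apply: (@CkSP _ _ _ (fun _ _ => 0)) => [|j]; last exact: IH.
exact: cst_continuous.
Qed.

Lemma Ck_coord m d j : Ck m (fun u : 'rV[R]_d => u 0 j).
Proof.
case: m => [|m]; first by split => //; exact: coord_continuous.
apply: (@CkSP _ _ _ (fun i _ => (delta_mx 0 i : 'rV[R]_d) 0 j)) => [|i x|i].
- exact: coord_continuous.
- suff cv : (fun k : R => k^-1 *: (((fun u : 'rV[R]_d => u 0 j) \o shift x)
      (k *: delta_mx 0 i) - x 0 j)) @ 0^' --> (delta_mx 0 i : 'rV[R]_d) 0 j.
    by split; [apply/cvg_ex; eexists; exact: cv|exact: cvg_lim].
  apply: cvg_near_cst; near=> k => /=.
  rewrite !mxE addrK [_ *: _]mulrA mulVf ?mul1r//.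
  by near: k; exact: nbhs_dnbhs_neq.
- exact: Ck_cst.
Unshelve. all: by end_near. Qed.

Lemma CkD m d (f g : 'rV[R]_d -> R) : Ck m f -> Ck m g ->
  Ck m (fun u => f u + g u).
Proof.
elim: m f g => [|m IH] f g fC gC.
  by split => // x; exact: (cvgD (Ck_continuous fC x) (Ck_continuous gC x)).
have hc : continuous (fun u => f u + g u).
  by move=> x; exact: (cvgD (Ck_continuous fC x) (Ck_continuous gC x)).
have hd j x : is_derive x (delta_mx 0 j) (fun u => f u + g u)
    ('D_(delta_mx 0 j) f x + 'D_(delta_mx 0 j) g x).
  exact: (is_deriveD (derivableP (Ck_derivable fC))
                     (derivableP (Ck_derivable gC))).
apply: (CkSP hc hd) => j.
by apply: IH; exact: Ck_derive.
Qed.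

Lemma CkM m d (f g : 'rV[R]_d -> R) : Ck m f -> Ck m g ->
  Ck m (fun u => f u * g u).
Proof.
elim: m f g => [|m IH] f g fC gC.
  by split => // x; exact: (cvgM (Ck_continuous fC x) (Ck_continuous gC x)).
have hc : continuous (fun u => f u * g u).
  by move=> x; exact: (cvgM (Ck_continuous fC x) (Ck_continuous gC x)).
have hd j x : is_derive x (delta_mx 0 j) (fun u => f u * g u)
    (f x * 'D_(delta_mx 0 j) g x + g x * 'D_(delta_mx 0 j) f x).
  exact: (is_deriveM (derivableP (Ck_derivable fC))
                     (derivableP (Ck_derivable gC))).
apply: (CkSP hc hd) => j.
(* The product rule keeps [f] and [g] themselves, which [CkW] lowers to class [m] for the
   induction. *)
by apply: CkD; apply: IH; try exact: CkW; exact: Ck_derive.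
Qed.

Lemma Ck_sum m d (I : Type) (s : seq I) (F : I -> 'rV[R]_d -> R) :
  (forall i, Ck m (F i)) -> Ck m (fun u => \sum_(i <- s) F i u).
Proof.
move=> FC; elim: s => [|i s IH].
  by under eq_fun do rewrite big_nil; exact: Ck_cst.
by under eq_fun do rewrite big_cons; exact: CkD.
Qed.

Lemma Ck_mulmx m d d' (A : 'M[R]_(d', d)) j :
  Ck m (fun u : 'rV[R]_d' => (u *m A) 0 j).
Proof.
under eq_fun do rewrite mxE.
by apply: Ck_sum => i; apply: CkM; [exact: Ck_coord|exact: Ck_cst].
Qed.

Lemma continuous_mulmxr d d' (A : 'M[R]_(d', d)) :
  continuous (fun u : 'rV[R]_d' => u *m A).
Proof.
(* Products of neighbourhoods of the entries form a base at a matrix, so continuity is checked entry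
   by entry. *)
move=> u P [Q uQ QP].
have uP : \forall v \near u, forall j, Q 0 j ((v *m A) 0 j).
  apply: (@filter_forall _ _ _ (nbhs u) (nbhs_filter u)) => j.
  exact: (Ck_continuous (Ck_mulmx 0 A j) u) (uQ 0 j).
apply: (@filterS _ (nbhs u) (nbhs_filter u)) uP => v H.
by apply: QP => i j; rewrite (ord1 i); exact: H.
Qed.

(** By the chain rule each partial derivative is a constant combination of partial derivatives of
    [h], composed with the same matrix, so the induction closes. *)
Lemma Ck_comp_mulmx m d d' (A : 'M[R]_(d', d)) (h : 'rV[R]_d -> R) :
  Ck m h -> Ck m (fun u => h (u *m A)).
Proof.
have hAc (g : 'rV[R]_d -> R) : continuous g ->
      continuous (fun u : 'rV[R]_d' => g (u *m A)).
  by move=> gc u; exact: continuous_comp (@continuous_mulmxr _ _ A u) (gc _).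
elim: m h => [|m IH] h hC; first by split => //; apply: hAc; case: hC.
apply: (@CkSP _ _ _ (fun j x => \sum_i (delta_mx 0 j *m A) 0 i *
    'D_(delta_mx 0 i) h (x *m A))).
- by apply: hAc; exact: Ck_continuous hC.
- move=> j x; apply: (is_derive_comp_line (phi := mulmxr A)
    (w := delta_mx 0 j *m A)); last exact: Ck_is_derive hC.
  by move=> k; rewrite linearP.
- move=> j; apply: Ck_sum => i; apply: CkM; first exact: Ck_cst.
  exact: IH (Ck_derive i hC).
Qed.

End CkCalculus.

(** * Linear maps in coordinates *)

Section Coordinates.
Context {R : realType}.
Implicit Types V W : vectType R.

Definition to_coords V (x : V) : 'rV[R]_(\dim {:V}) :=
  \row_j coord (vbasis {:V}) j x.

Lemma to_coordsK V : cancel (@to_coords V) (@of_coords R V).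
Proof.
move=> x; rewrite [RHS](coord_vbasis (memvf x)).
by apply: eq_bigr => j _; rewrite mxE.
Qed.

Lemma of_coordsK V : cancel (@of_coords R V) (@to_coords V).
Proof.
move=> u; apply/rowP => j; rewrite mxE /of_coords coord_sum_free//.
exact: basis_free (vbasisP _).
Qed.

Lemma to_coords_is_linear V : linear (@to_coords V).
Proof. by move=> a x y; apply/rowP => j; rewrite !mxE linearP. Qed.

HB.instance Definition _ V := GRing.isLinear.Build R V _ _ (@to_coords V)
  (@to_coords_is_linear V).

Lemma of_coords_is_linear V : linear (@of_coords R V).
Proof.
move=> a u v; apply: (can_inj (@to_coordsK V)).
by rewrite linearP/= !of_coordsK.
Qed.

HB.instance Definition _ V := GRing.isLinear.Build R _ V _ (@of_coords R V)
  (@of_coords_is_linear V).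

Lemma linear_coords V W (L : {linear V -> W}) :
  exists A, forall u, L (of_coords u) = of_coords (u *m A).
Proof.
exists (lin1_mx (@to_coords W \o L \o @of_coords R V)) => u.
by rewrite mul_rV_lin1 /= to_coordsK.
Qed.

End Coordinates.

(** * Smooth and compactly supported functions *)

Section Smooth.
Context {R : realType}.
Implicit Types V W : vectType R.

Lemma smooth_comp_linear V W (L : {linear V -> W}) (f : W -> R[i]) :
  smooth f -> smooth (f \o L).
Proof.
move=> fs m; have [fRe fIm] := fs m; have [A LA] := linear_coords L.
have -> : (fun u => complex.Re ((f \o L) (of_coords u))) =
    (fun u => complex.Re (f (of_coords (u *m A)))).
  by apply/funext => u /=; rewrite LA.
have -> : (fun u => complex.Im ((f \o L) (of_coords u))) =
    (fun u => complex.Im (f (of_coords (u *m A)))).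
  by apply/funext => u /=; rewrite LA.
by split; [exact: (Ck_comp_mulmx A fRe)|exact: (Ck_comp_mulmx A fIm)].
Qed.

Lemma smooth_cst V (c : R[i]) : smooth (fun _ : V => c).
Proof. by move=> m; split; exact: Ck_cst. Qed.

Lemma smoothD V (f g : V -> R[i]) : smooth f -> smooth g ->
  smooth (fun x => f x + g x).
Proof.
move=> fs gs m; have [fRe fIm] := fs m; have [gRe gIm] := gs m.
have -> : (fun u => complex.Re (f (of_coords u) + g (of_coords u))) =
    (fun u => complex.Re (f (of_coords u)) + complex.Re (g (of_coords u))).
  by apply/funext => u; case: (f _) (g _) => [a b] [c d].
have -> : (fun u => complex.Im (f (of_coords u) + g (of_coords u))) =
    (fun u => complex.Im (f (of_coords u)) + complex.Im (g (of_coords u))).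
  by apply/funext => u; case: (f _) (g _) => [a b] [c d].
by split; exact: CkD.
Qed.

Lemma ReM (c z : R[i]) : complex.Re (c * z) =
  complex.Re c * complex.Re z + - complex.Im c * complex.Im z.
Proof. by case: c z => [a b] [x y] /=; rewrite mulNr. Qed.

Lemma ImM (c z : R[i]) : complex.Im (c * z) =
  complex.Im c * complex.Re z + complex.Re c * complex.Im z.
Proof. by case: c z => [a b] [x y] /=; rewrite addrC. Qed.

Lemma smoothZ V (c : R[i]) (f : V -> R[i]) : smooth f ->
  smooth (fun x => c * f x).
Proof.
move=> fs m; have [fRe fIm] := fs m; split.
  under eq_fun do rewrite ReM.
  by apply: CkD; apply: CkM => //; exact: Ck_cst.
under eq_fun do rewrite ImM.
by apply: CkD; apply: CkM => //; exact: Ck_cst.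
Qed.

(** Heine-Borel in coordinates: vanishing outside a ball is easier to propagate than compactness of
    a closure. *)
Lemma compactly_supportedP V (f : V -> R[i]) :
  compactly_supported f <->
  exists M : R, forall u, M < `|u| -> f (of_coords u) = 0.
Proof.
split=> [/compact_bounded [M [Mreal bM]]|[M fM]].
  (* [bM] bounds the set by each number strictly greater than [M], hence the 1. *)
  exists (M + 1) => u Mu; apply/eqP; apply: contraTT Mu => fu.
  rewrite -leNgt; apply: bM; first by rewrite ltrDl.
  exact: subset_closure.
have clM : closed [set u : 'rV[R]_(\dim {:V}) | `|u| <= M].
  apply: (@preimage_closed _ _ (fun u : 'rV[R]_(\dim {:V}) => `|u|)
    [set r : R | r <= M]) => [u _|]; first exact: norm_continuous.
  exact: closed_le.
have sub : closure [set u | f (of_coords u) != 0] `<=` [set u | `|u| <= M].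
  rewrite [X in _ `<=` X](iffLR (closure_id _) clM); apply: closureS => u /= fu.
  by rewrite leNgt; apply: contra fu => Mu; rewrite fM.
apply: bounded_closed_compact; last exact: closed_closure.
exists M; split; first exact: num_real.
by move=> x Mx u /sub /= /le_trans; apply; exact: ltW.
Qed.

(** In coordinates the left inverse is Lipschitz, so $|u|\le c|uA|$: a large [u] has a large image
    under [L], where [f] vanishes. *)
Lemma compactly_supported_comp V W (L : {linear V -> W}) (L' : {linear W -> V})
    (f : W -> R[i]) :
  cancel L L' -> compactly_supported f -> compactly_supported (f \o L).
Proof.
move=> LK /compactly_supportedP [M fM]; apply/compactly_supportedP.
have [A LA] := linear_coords L; have [B LB] := linear_coords L'.
have Bc : continuous (mulmxr B : 'rV_(\dim {:W}) -> 'rV_(\dim {:V})).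
  exact: continuous_mulmxr.
have [c c0 cB] := linear_lipschitz Bc.
exists (c * M) => u Mu /=; rewrite LA fM//.
rewrite -(ltr_pM2l c0); apply: (lt_le_trans Mu).
have uE : u = mulmxr B (u *m A).
  by apply: (can_inj (@of_coordsK R V)); rewrite /= -LB -LA LK.
by rewrite {1}uE; exact: cB.
Qed.

End Smooth.

(** * Left-invariant vector fields *)

Lemma derive1_line {R : realType} {V : normedModType R} (h : V -> R) y e :
  derive1 (fun t : R => h (t *: e + y)) 0 = 'D_e h y.
Proof.
rewrite /derive1 /derive.
suff -> : (fun t : R => t^-1 *: (h ((t + 0) *: e + y) - h (0 *: e + y))) =
    (fun t : R => t^-1 *: ((h \o shift y) (t *: e) - h y)) by [].
by apply/funext => t /=; rewrite addr0 scale0r add0r.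
Qed.

Section LeftInvariantFields.
Context {R : realType} {V Z : vectType R} (br : {bilinear V -> V -> Z}).
Local Notation N := (V * Z)%type.
Implicit Types (x y Y : N) (f : N -> R[i]).

Lemma gmulA x y z : gmul br x (gmul br y z) = gmul br (gmul br x y) z.
Proof.
rewrite /gmul /= linearDl linearDr /= !scalerDr.
congr (_, _); first exact: addrA.
rewrite -!addrA; congr (_ + (_ + _)); rewrite [RHS]addrCA; congr (_ + _).
by rewrite addrC -addrA.
Qed.

(** The part of the direction of the field [Y] at [x] that varies with [x]. It is linear in [x], so
    the whole direction is affine. *)
Definition bracket_dir Y x : N := (0, 2^-1 *: br x.1 Y.1).

Lemma bracket_dir_is_linear Y : linear (bracket_dir Y).
Proof.
move=> a x y; rewrite /bracket_dir; congr (_, _) => /=.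
  by rewrite scaler0 addr0.
by rewrite linearPl scalerDr !scalerA mulrC.
Qed.

HB.instance Definition _ Y := GRing.isLinear.Build R N N _ (bracket_dir Y)
  (bracket_dir_is_linear Y).

Lemma gmul_line x Y (t : R) :
  gmul br x (t *: Y) = t *: (Y + bracket_dir Y x) + x.
Proof.
rewrite /gmul /bracket_dir /= linearZr /=; congr (_, _) => /=.
  by rewrite addr0 addrC.
by rewrite -addrA addrC scalerDr !scalerA mulrC.
Qed.

Lemma lvf_coords Y f u :
  let v := to_coords (Y + bracket_dir Y (of_coords u)) in
  lvf br Y f (of_coords u) =
  ('D_v (fun u => complex.Re (f (of_coords u))) u +i*
   'D_v (fun u => complex.Im (f (of_coords u))) u)%C.
Proof.
move=> v; rewrite /lvf -!derive1_line.
have E t : gmul br (of_coords u) (t *: Y) = of_coords (t *: v + u).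
  by rewrite linearP/= to_coordsK gmul_line.
by congr (derive1 _ 0 +i* derive1 _ 0)%C; apply/funext => t; rewrite E.
Qed.

(** In coordinates the field is $\sum_j v_j(u)\partial_j$ with affine $v_j$. It costs one
    derivative, so class $C^m$ of the result uses class $C^{m+1}$ of [f]. *)
Lemma smooth_lvf Y f : smooth f -> smooth (lvf br Y f).
Proof.
move=> fs m; have [fRe fIm] := fs m.+1.
have vC j : Ck m (fun u : 'rV_(\dim {:N}) =>
    (to_coords (Y + bracket_dir Y (of_coords u)) : 'rV_(\dim {:N})) 0 j).
  have [A LA] := linear_coords (bracket_dir Y).
  under eq_fun do rewrite linearD/= LA of_coordsK mxE.
  by apply: CkD; [exact: Ck_cst|exact: Ck_mulmx].
suff main (h : 'rV_(\dim {:N}) -> R) : Ck m.+1 h ->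
    Ck m (fun u => 'D_(to_coords (Y + bracket_dir Y (of_coords u))) h u).
  split.
    under eq_fun do rewrite lvf_coords.
    exact: main.
  under eq_fun do rewrite lvf_coords.
  exact: main.
move=> hC.
under eq_fun => u do rewrite (@derive_val _ _ _ _ _ _ _ (Ck_is_derive _ _ hC)).
by apply: Ck_sum => j; apply: CkM => //; exact: Ck_derive.
Qed.

Lemma smooth_word w f : smooth f -> smooth (word_act br w f).
Proof. by move=> fs; elim: w => //= Y w; exact: smooth_lvf. Qed.

Lemma lvf_mulc Y (c : R[i]) f : smooth f ->
  lvf br Y (fun x => c * f x) = (fun x => c * lvf br Y f x).
Proof.
move=> fs; apply/funext => x; rewrite -(to_coordsK x) !lvf_coords.
have [fRe fIm] := fs 1; set u := to_coords x; set v := to_coords _.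
have [dRe _] := Ck_is_derive u v fRe; have [dIm _] := Ck_is_derive u v fIm.
pose Re u := complex.Re (f (of_coords u)).
pose Im u := complex.Im (f (of_coords u)).
(* A complex factor mixes real and imaginary parts, so a general real combination of both is
   differentiated. *)
have E a b :
    'D_v (fun u => a * Re u + b * Im u) u = a * 'D_v Re u + b * 'D_v Im u.
  exact: (@derive_val _ _ _ _ _ _ _ (is_deriveD
    (is_deriveZ a (derivableP dRe)) (is_deriveZ b (derivableP dIm)))).
apply/eqP; rewrite eq_complex; apply/andP; split; apply/eqP.
  transitivity ('D_v (fun u => complex.Re c * Re u + - complex.Im c * Im u) u).
    by apply: (congr1 (fun h => 'D_v h u)); apply/funext => w; exact: ReM.
  by rewrite E ReM.
transitivity ('D_v (fun u => complex.Im c * Re u + complex.Re c * Im u) u).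
  by apply: (congr1 (fun h => 'D_v h u)); apply/funext => w; exact: ImM.
by rewrite E ImM.
Qed.

Lemma word_mulc w (c : R[i]) f : smooth f ->
  word_act br w (fun x => c * f x) = (fun x => c * word_act br w f x).
Proof.
by move=> fs; elim: w => //= Y w ->; rewrite lvf_mulc//; exact: smooth_word.
Qed.

Lemma lvf_dirZ Y (a : R) f x : smooth f ->
  lvf br (a *: Y) f x = (a%:C)%C * lvf br Y f x.
Proof.
move=> fs; rewrite -(to_coordsK x) !lvf_coords; set u := to_coords x.
have -> : to_coords (a *: Y + bracket_dir (a *: Y) (of_coords u)) =
    a *: to_coords (Y + bracket_dir Y (of_coords u)).
  rewrite -linearZ/= scalerDr; congr (to_coords (_ + _)).
  rewrite /bracket_dir /= linearZr /=; congr (_, _) => /=.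
    by rewrite scaler0.
  by rewrite !scalerA mulrC.
have [fRe fIm] := fs 1; set v := to_coords _.
have E (h : 'rV_(\dim {:N}) -> R) : Ck 1 h -> 'D_(a *: v) h u = a * 'D_v h u.
  move=> hC; have [_ ->] := Ck_is_derive u v hC.
  have [_ ->] := Ck_is_derive u (a *: v) hC.
  by rewrite mulr_sumr; apply: eq_bigr => j _; rewrite mxE mulrA.
by rewrite !E//; apply/eqP; rewrite eq_complex /= !mul0r subr0 addr0 !eqxx.
Qed.

(** The exterior of the ball is open, so [f] vanishes near each of its points and so do the
    derivatives there; the same radius serves. *)
Lemma compactly_supported_lvf Y f : compactly_supported f ->
  compactly_supported (lvf br Y f).
Proof.
move=> /compactly_supportedP [M fM].
apply/compactly_supportedP; exists M => u Mu.
have near0 : \forall w \near u, f (of_coords w) = 0.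
  apply: (@filterS _ (nbhs u) (nbhs_filter u) _ _ fM).
  exact: (@cvgr_gt _ _ (nbhs u) (nbhs_filter u) _ _ (@norm_continuous _ _ u)).
rewrite lvf_coords; set v := to_coords _.
have E (pr : R[i] -> R) : pr 0 = 0 ->
    'D_v (fun u => pr (f (of_coords u))) u = 0.
  move=> pr0; rewrite -[RHS](derive_cst (0 : R) u v); apply: near_eq_derive.
  by near=> w; rewrite (_ : f (of_coords w) = 0)//; near: w.
by rewrite !E.
Unshelve. all: by end_near. Qed.

Lemma compactly_supported_word w f : compactly_supported f ->
  compactly_supported (word_act br w f).
Proof. by move=> fc; elim: w => //= Y w; exact: compactly_supported_lvf. Qed.

(** Left invariance, by associativity of the product. *)
Lemma lvf_gmul Y f x : lvf br Y (f \o gmul br x) = lvf br Y f \o gmul br x.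
Proof.
by apply/funext => y; rewrite /lvf /=; under eq_fun do rewrite gmulA;
   under [X in (_ +i* derive1 X _)%C]eq_fun do rewrite gmulA.
Qed.

Lemma word_gmul w f x :
  word_act br w (f \o gmul br x) = word_act br w f \o gmul br x.
Proof. by elim: w => //= Y w ->; rewrite lvf_gmul. Qed.

Lemma dil_is_linear (t : R) : linear (@dil R V Z t).
Proof.
by move=> a x y; rewrite /dil; congr (_, _) => /=;
   rewrite scalerDr !scalerA mulrC.
Qed.

HB.instance Definition _ t := GRing.isLinear.Build R N N _ (@dil R V Z t)
  (dil_is_linear t).

Lemma dil_gmul (t : R) x y : dil t (gmul br x y) = gmul br (dil t x) (dil t y).
Proof.
rewrite /dil /gmul /= linearZl_LR linearZr_LR /=; congr (_, _).
  by rewrite scalerDr.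
by rewrite !scalerDr !scalerA expr2 [_ * 2^-1]mulrC mulrA.
Qed.

(** Dilations are automorphisms, so they carry lines [gmul br x (s *: Y)] to lines in the direction
    [dil t Y]. *)
Lemma lvf_dil Y f (t : R) x :
  lvf br Y (f \o dil t) x = lvf br (dil t Y) f (dil t x).
Proof.
have E s : dil t (gmul br x (s *: Y)) = gmul br (dil t x) (s *: dil t Y).
  by rewrite dil_gmul linearZ.
by rewrite /lvf /=; congr (derive1 _ 0 +i* derive1 _ 0)%C; apply/funext => s;
   rewrite E.
Qed.

End LeftInvariantFields.

(** * Homogeneity under dilations *)

Section Homogeneity.
Context {R : realType} {V Z : vectType R} (br : {bilinear V -> V -> Z}).
Local Notation N := (V * Z)%type.

(** Words are formal products, so the degree is tested through their action on smooth functions. *)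
Definition homogeneous_word (m : nat) (w : seq N) :=
  forall (f : N -> R[i]) (t : R), smooth f ->
    word_act br w (f \o dil t) =
    (fun x => ((t ^+ m)%:C)%C * word_act br w f (dil t x)).

Lemma homogeneous_nil : homogeneous_word 0 [::].
Proof. by move=> f t _; apply/funext => x; rewrite expr0 mul1r. Qed.

Lemma homogeneous_cat m1 m2 w1 w2 :
  homogeneous_word m1 w1 -> homogeneous_word m2 w2 ->
  homogeneous_word (m1 + m2) (w1 ++ w2).
Proof.
move=> h1 h2 f t fs; rewrite /word_act !foldr_cat -!/(word_act _ _ _) h2//.
have gs : smooth (word_act br w2 f) by exact: smooth_word.
(* The power of [t] produced by [w2] has to pass through [w1] before [w1] meets the dilation. *)
rewrite (word_mulc _ _ _ (smooth_comp_linear (dil t) gs)) h1//.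
by apply/funext => x; rewrite mulrA -rmorphM -exprD addnC.
Qed.

Lemma homogeneous_letter m Y : (forall t : R, dil t Y = t ^+ m *: Y) ->
  homogeneous_word m [:: Y].
Proof.
by move=> YE f t fs; apply/funext => x; rewrite /= lvf_dil YE lvf_dirZ.
Qed.

Variable F : fieldType.
Implicit Types D E : diffop F N.

(** Imposed word by word, it ignores the coefficients and makes sense over $\mathbb C(s)$. *)
Definition homogeneous (m : nat) D := {in D, forall a, homogeneous_word m a.2}.

Lemma homogeneous_op1 : homogeneous 0 (op1 F N).
Proof. by move=> a; rewrite inE => /eqP ->; exact: homogeneous_nil. Qed.

Lemma homogeneous_opadd m D E : homogeneous m D -> homogeneous m E ->
  homogeneous m (opadd D E).
Proof. by move=> hD hE a; rewrite mem_cat => /orP[/hD|/hE]. Qed.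

Lemma homogeneous_opscale m c D : homogeneous m D ->
  homogeneous m (opscale c D).
Proof. by move=> hD a /mapP[b bD ->]; exact: (hD b bD). Qed.

Lemma homogeneous_opsub m D E : homogeneous m D -> homogeneous m E ->
  homogeneous m (opsub D E).
Proof.
by move=> hD hE; apply: homogeneous_opadd => //; exact: homogeneous_opscale.
Qed.

Lemma homogeneous_opmul m1 m2 D E : homogeneous m1 D -> homogeneous m2 E ->
  homogeneous (m1 + m2) (opmul D E).
Proof.
move=> hD hE a /allpairsP[[b c] /= [bD cE ->]].
by apply: homogeneous_cat; [exact: (hD b bD)|exact: (hE c cE)].
Qed.

Lemma homogeneous_sum_squares m (s : seq N) :
  {in s, forall Y, homogeneous_word m [:: Y]} ->
  homogeneous (m + m) (sum_squares F s).
Proof.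
move=> hs a /mapP[Y Ys ->].
by apply: (@homogeneous_cat _ _ [:: Y]); exact: (hs Y Ys).
Qed.

(** The two terms defining $D_{s,k+1}$ have degrees $2+2k$ and $4+2(k-1)$, which agree. *)
Lemma homogeneous_Dsk p1 p2 q Lap1 Lap2 Box k (s : F) :
  homogeneous 2 Lap1 -> homogeneous 2 Lap2 -> homogeneous 4 Box ->
  homogeneous (2 * k) (Dsk p1 p2 q Lap1 Lap2 Box k s).
Proof.
move=> h1 h2 h4.
have h12 : homogeneous 2 (opadd Lap1 Lap2) by exact: homogeneous_opadd.
(* The recursion reaches two steps back, so two consecutive values of [k] are carried, with [s]
   general because of the shift to [s - 1]. *)
suff : homogeneous (2 * k) (Dsk p1 p2 q Lap1 Lap2 Box k s) /\
       homogeneous (2 * k.+1) (Dsk p1 p2 q Lap1 Lap2 Box k.+1 s) by case.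
elim: k s => [|k IH] s.
  split; first exact: homogeneous_op1.
  by apply/homogeneous_opscale/homogeneous_opsub; exact: homogeneous_opscale.
split; first by have [] := IH s.
apply/homogeneous_opscale/homogeneous_opsub.
  rewrite mulnS; apply: homogeneous_opmul; last by have [] := IH s.
  by apply/homogeneous_opsub; exact: homogeneous_opscale.
apply/homogeneous_opscale; rewrite !mulnS addnA.
apply: homogeneous_opmul; last by have [] := IH (s - 1).
apply: homogeneous_opadd; last exact: homogeneous_opscale.
exact: (@homogeneous_opmul 2 2).
Qed.

End Homogeneity.

(** * Operators over $\mathbb C$ and over $\mathbb C(s)$ *)

Section Operators.
Context {R : realType} (n : htype R).
Local Notation C := R[i].
Local Notation N := (hv n * hz n)%type.
Local Notation K := {fraction {poly C}}.
Local Notation "p %:F" := (@FracField.tofrac {poly C} p).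
Implicit Types (f g : N -> C) (x y : N) (E : diffop C N).

Lemma op_act_nil f : op_act [::] f = fun _ => 0 : C.
Proof. by apply/funext => x; rewrite /op_act big_nil. Qed.

Lemma op_act_cons a E f :
  op_act (a :: E) f = fun x => a.1 * word_act (hbr n) a.2 f x + op_act E f x.
Proof. by apply/funext => x; rewrite /op_act big_cons. Qed.

Lemma smooth_op_act E f : smooth f -> smooth (op_act E f).
Proof.
move=> fs; elim: E => [|a E IH]; first by rewrite op_act_nil; exact: smooth_cst.
rewrite op_act_cons; apply: smoothD => //; apply: smoothZ; exact: smooth_word.
Qed.

Lemma compactly_supported_op_act E f : compactly_supported f ->
  compactly_supported (op_act E f).
Proof.
move=> fc; apply/compactly_supportedP.
elim: E => [|a E [M1 IH]].
  by exists 0 => u _; rewrite op_act_nil.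
have /compactly_supportedP [M2 wM] :=
  @compactly_supported_word _ _ _ (hbr n) a.2 f fc.
exists (Num.max M1 M2) => u; rewrite gt_max => /andP[/IH Eu /wM wu].
by rewrite op_act_cons wu mulr0 add0r.
Qed.

Lemma op_act_mulc E c f : smooth f ->
  op_act E (fun x => c * f x) = (fun x => c * op_act E f x).
Proof.
move=> fs; apply/funext => x; rewrite mulr_sumr; apply: eq_bigr => a _.
by rewrite word_mulc// mulrCA.
Qed.

Lemma op_act_gmul E f x :
  op_act E (f \o gmul (hbr n) x) = op_act E f \o gmul (hbr n) x.
Proof. by apply/funext => y; apply: eq_bigr => a _; rewrite word_gmul. Qed.

(* D = P / d, so an identity over C(s) between values of D is one between
   polynomials in s, which may be evaluated at s0. *)
Lemma value_at_identity (D : diffop K N) s0 E c f g x y :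
  value_at D s0 E -> smooth f -> smooth g ->
  op_actK D f x = (c%:P)%:F * op_actK D g y ->
  op_act E f x = c * op_act E g y.
Proof.
move=> [P [d [ds0 DP ->]]] fs gs.
pose Q h z : {poly C} := \sum_(a <- P) a.1 * (word_act (hbr n) a.2 h z)%:P.
have DQ h z : smooth h -> op_actK D h z = (Q h z)%:F / d%:F.
  move=> /DP ->; rewrite /op_actK big_map /Q rmorph_sum mulr_suml.
  by apply: eq_bigr => a _; rewrite rmorphM /= mulrAC.
have EQ h z : op_act [seq (a.1.[s0] / d.[s0], a.2) | a <- P] h z =
    (Q h z).[s0] / d.[s0].
  rewrite /op_act big_map horner_sum mulr_suml.
  by apply: eq_bigr => a _; rewrite hornerM hornerC mulrAC.
have dF : d%:F != 0.
  by rewrite tofrac_eq0; apply: contraNneq ds0 => ->; rewrite horner0.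
rewrite !DQ// mulrA => /(mulIf (invr_neq0 dF)).
rewrite -rmorphM => /eqP; rewrite tofrac_eq => /eqP Qfg.
by rewrite !EQ Qfg hornerM hornerC mulrA.
Qed.

Lemma op_actK_dil m (D : diffop K N) f (t : R) x :
  homogeneous (hbr n) m D -> smooth f ->
  op_actK D (f \o dil t) x = ((((t ^+ m)%:C)%C)%:P)%:F * op_actK D f (dil t x).
Proof.
move=> hD fs; rewrite /op_actK mulr_sumr !big_seq; apply: eq_bigr => a aD.
by rewrite (hD a aD)// polyCM rmorphM mulrCA.
Qed.

Lemma homogeneous_Drat (v1 v2 : {vspace hv n}) S1 S2 T k :
  homogeneous (hbr n) (2 * k) (Drat v1 v2 S1 S2 T k).
Proof.
apply: homogeneous_Dsk.
(* Letters from $\mathfrak v$ have degree 1 and letters from $\mathfrak z$ degree 2, whence degree 2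
   for the two Laplacians and 4 for [Box]. *)
- apply: (@homogeneous_sum_squares _ _ _ _ _ 1) => Y /mapP[X _ ->].
  by apply: homogeneous_letter => t; congr (_, _); rewrite /= ?expr1 ?scaler0.
- apply: (@homogeneous_sum_squares _ _ _ _ _ 1) => Y /mapP[X _ ->].
  by apply: homogeneous_letter => t; congr (_, _); rewrite /= ?expr1 ?scaler0.
- apply: (@homogeneous_sum_squares _ _ _ _ _ 2) => Y /mapP[X _ ->].
  by apply: homogeneous_letter => t; congr (_, _); rewrite /= ?scaler0.
Qed.

End Operators.

(** * Restriction to $N_1$ *)

Section Restriction.
Context {R : realType} {n : htype R} (v1 : {vspace hv n}).
Local Notation N := (hv n * hz n)%type.
Local Notation N1 := (subvs_of v1 * hz n)%type.

Lemma inclN1_is_linear : linear (inclN1 v1).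
Proof. by move=> a x y; congr (_, _); rewrite /= linearP. Qed.

HB.instance Definition _ := GRing.isLinear.Build R N1 N _ (inclN1 v1)
  inclN1_is_linear.

(** A linear left inverse of the inclusion, which shows that restriction keeps supports bounded. *)
Definition projN1 (x : N) : N1 := (vsproj v1 x.1, x.2).

Lemma projN1_is_linear : linear projN1.
Proof. by move=> a x y; congr (_, _); rewrite /= linearP. Qed.

HB.instance Definition _ := GRing.isLinear.Build R N N1 _ projN1
  projN1_is_linear.

Lemma inclN1K : cancel (inclN1 v1) projN1.
Proof. by move=> [x z]; rewrite /inclN1 /projN1 /= vsvalK. Qed.

Lemma Cc_smooth_restrN1 (f : N -> R[i]) :
  Cc_smooth f -> Cc_smooth (restrN1 v1 f).
Proof.
move=> [fs fc]; split; first exact: (smooth_comp_linear (inclN1 v1)).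
exact: (compactly_supported_comp inclN1K).
Qed.

End Restriction.

(** * The character of $A$ and the intertwining property *)

Lemma cpowR_addn {R : realType} (t : R) (z : R[i]) (m : nat) : 0 < t ->
  cpowR t (- (z + m%:R)) = cpowR t (- z) * ((t^-1 ^+ m)%:C)%C.
Proof.
move=> t0; have mE : m%:R = (m%:R : R)%:C%C by rewrite rmorph_nat.
(* The added integer is real: the phase of [cpowR] is unchanged and only the exponential factor
   gains $e^{-m\ln t}$. *)
have -> : t^-1 ^+ m = expR (- m%:R * ln t).
  by rewrite mulNr -mulrN expRM_natl expRN lnK ?posrE.
rewrite mE /cpowR; case: z => a b /=.
rewrite addr0 opprD mulrDl expRD !rmorphM /=.
by rewrite mulrAC.
Qed.

Theorem theorem3p6 (R : realType) (n : htype R) (v1 v2 : {vspace hv n})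
    (hsub : htype_sub v1 v2)
    (S1 S2 : seq (hv n)) (T : seq (hz n))
    (hS1 : orthonormal_basis (dotv n) v1 S1)
    (hS2 : orthonormal_basis (dotv n) v2 S2)
    (hT : orthonormal_basis (dotz n) fullv T)
    (k : nat) (nu : R[i]) (D : diffop R[i] (hv n * hz n))
    (hD : value_at (Drat v1 v2 S1 S2 T k) (- nu / 2) D) :
  let Dnuk := fun f : hv n * hz n -> R[i] => restrN1 v1 (op_act D f) in
  (forall f, Cc_smooth f -> Cc_smooth (Dnuk f)) /\
  (forall (g : (subvs_of v1 * hz n) * R) (f : hv n * hz n -> R[i]),
     0 < g.2 -> Cc_smooth f ->
     Dnuk (pi_rep nu (inclN1 v1 g.1, g.2) f)
       =1 pi_flat (nu + 2 * k%:R) g (Dnuk f)).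
Proof.
move=> Dnuk; split=> [f [fs fc]|[m t] f /= t0 [fs _] y].
  apply: Cc_smooth_restrN1; split; first exact: smooth_op_act.
  exact: compactly_supported_op_act.
have fts : smooth (f \o dil t^-1) by exact: (smooth_comp_linear (dil t^-1)).
rewrite /Dnuk /restrN1 /= /pi_rep /rep /=.
(* Left invariance removes the translation and linearity the scalar $t^{-\nu}$; the dilation by
   $t^{-1}$ remains. *)
rewrite (op_act_gmul D (fun x => cpowR t (- nu) * f (dil t^-1 x))) /=.
rewrite (op_act_mulc _ _ fts).
have hom := @homogeneous_Drat R n v1 v2 S1 S2 T k.
(* Homogeneity over $\mathbb C(s)$ gives the factor $(t^{-1})^{2k}$, constant in $s$, and is
   specialised to $s=-\nu/2$. *)
rewrite (value_at_identity hD fts fs (op_actK_dil _ _ hom fs)).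
(* The points agree by conversion: the inclusion of $N_1$ respects products, inverses and
   dilations. *)
by rewrite mulrA /pi_flat /rep /= -natrM cpowR_addn//.
Qed.
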